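(* Let $\mathbb{K}$ be a field and $\nu$ a valuation on $\mathbb{K}[x]$. Then $\nu$ is valuation-transcendental if and only if there exists a key polynomial $Q\in\mathbb{K}[x]$ for $\nu$ such that $\nu=\nu_Q$.
   Context: A valuation on a commutative ring $R$ is a map $\nu:R\to\Gamma\cup\{\infty\}$ ($\Gamma$ an ordered abelian group) with $\nu(ab)=\nu(a)+\nu(b)$, $\nu(a+b)\ge\min\{\nu(a),\nu(b)\}$, $\nu(1)=0$, $\nu(0)=\infty$. Its support is $\mathrm{supp}(\nu)=\{a:\nu(a)=\infty\}$; $\nu$ is Krull if $\mathrm{supp}(\nu)=\{0\}$. A Krull valuation on $\mathbb{K}[x]$ extends uniquely to $\mathbb{K}(x)$; $\nu\mathbb{K}(x)$ and $\nu\mathbb{K}$ denote the value groups of $\nu$ on $\mathbb{K}(x)$ and on $\mathbb{K}$, and $\mathbb{K}(x)\nu$, $\mathbb{K}\nu$ the residue fields. Truncation: for a non-constant $q\in\mathbb{K}[x]$, every $f$ has a unique $q$-expansion $f=f_0+f_1q+\dots+f_sq^s$ with $\deg f_i<\deg q$; set $\nu_q(f)=\min_i\nu(f_iq^i)$. Key polynomials: let $\alpha=\min\{\deg g: g\in\mathrm{supp}(\nu)\setminus\{0\}\}$ if $\mathrm{supp}(\nu)\neq\{0\}$, and $\alpha=\infty$ otherwise. The Hasse derivative of order $b$ of $f=\sum a_ix^i$ is $\partial_bf=\sum_{i\ge b}\binom{i}{b}a_ix^{i-b}$. For nonzero $f$: if $0<\deg f<\alpha$, $\epsilon(f)=\max_{1\le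 b\le\deg f}\{(\nu(f)-\nu(\partial_bf))/b : \nu(f),\nu(\partial_bf)\in\Gamma\}\in\Gamma\otimes\mathbb{Q}$; if $\deg f=0$, $\epsilon(f)=-\infty$; if $f$ generates $\mathrm{supp}(\nu)$, $\epsilon(f)=\infty$. A monic $Q\in\mathbb{K}[x]$ is a key polynomial for $\nu$ if for every $f$ (for which $\epsilon(f)$ is defined), $\epsilon(f)\ge\epsilon(Q)$ implies $\deg f\ge\deg Q$. $\nu$ is value-transcendental if it is not Krull or $\nu\mathbb{K}(x)/\nu\mathbb{K}$ is not a torsion group; $\nu$ (Krull) is residue-transcendental if $\mathbb{K}(x)\nu\mid\mathbb{K}\nu$ is transcendental; $\nu$ is valuation-transcendental if it is value-transcendental or residue-transcendental. *)

(* Defs.v *)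
From HB Require Import structures.
From mathcomp Require Import all_boot all_order all_algebra.
Set Implicit Arguments. Unset Strict Implicit. Unset Printing Implicit Defensive.
Import Order.TTheory GRing.Theory Num.Theory.
Local Open Scope ring_scope.

Definition ordered_group (G : porderZmodType) : Prop :=
  (forall x y : G, (x <= y) || (y <= x)) /\
  (forall x y z : G, x <= y -> x + z <= y + z).

Section Defs.
Variables (K : fieldType) (G : porderZmodType).

(* Gamma u {oo} is represented by option G, with None = oo. *)
Definition vadd (a b : option G) : option G :=
  match a, b with Some x, Some y => Some (x + y) | _, _ => None end.
Definition vle (a b : option G) : bool :=
  match a, b with
  | _, None => true
  | None, Some _ => false
  | Some x, Some y => x <= y
  end.
Definition vmin (a b : option G) : option G := if vle a b then a else b.

Variable nu : {poly K} -> option G.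

Definition valuation : Prop :=
  (forall a b, nu (a * b) = vadd (nu a) (nu b)) /\
  (forall a b, vle (vmin (nu a) (nu b)) (nu (a + b))) /\
  nu 1 = Some 0 /\ nu 0 = None.

Definition krull : Prop := forall f, nu f = None -> f = 0.

(* nu K(x) / nu K is not torsion: some value nu(f) - nu(g) of K(x)^* has no
   positive multiple in nu K = {nu(c) : c in K^*}. *)
Definition value_transcendental : Prop :=
  ~ krull \/
  (krull /\ exists (f g : {poly K}) (vf vg : G),
     nu f = Some vf /\ nu g = Some vg /\
     forall (n : nat) (c : K), (0 < n)%N -> c != 0 ->
       nu c%:P <> Some ((vf - vg) *+ n)).

(* K(x)nu | K nu is transcendental: some phi = f/g in K(x) with nu(phi) >= 0
   has a residue that is a root of no nonzero polynomial over K nu.  A nonzero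
   polynomial over K nu is the reduction of some P in O_K[t] having a
   coefficient of value 0, and Pbar(phibar) <> 0 iff nu(P(phi)) = 0, i.e.
   nu(g^n P(f/g)) = n nu(g) with n = deg P. *)
Definition residue_transcendental : Prop :=
  krull /\
  exists (f g : {poly K}) (vg : G),
    nu g = Some vg /\ vle (Some vg) (nu f) /\
    forall P : {poly K},
      (forall i, vle (Some 0) (nu (P`_i)%:P)) ->
      (exists i, nu (P`_i)%:P = Some 0) ->
      nu (\sum_(i < size P) P`_i *: (f ^+ i * g ^+ ((size P).-1 - i)))
        = Some (vg *+ (size P).-1).

Definition valuation_transcendental : Prop :=
  value_transcendental \/ residue_transcendental.

(* Truncation nu_q: the q-expansion f = sum_i f_i q^i (deg f_i < deg q) has
   digits f_i = (f %/ q^i) %% q; the expansion has at most size f terms. *)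
Definition qcoef (q f : {poly K}) (i : nat) : {poly K} := (f %/ q ^+ i) %% q.
Definition nuQ (q f : {poly K}) : option G :=
  \big[vmin/None]_(i < size f) nu (qcoef q f i * q ^+ i).

(* Values of epsilon, in (Gamma (x) Q) u {-oo, +oo}; EpsFin g b stands for
   g / b (b > 0). *)
Inductive epsv := EpsNInf | EpsFin of G & nat | EpsInf.

Definition eps_le (x y : epsv) : bool :=
  match x, y with
  | EpsNInf, _ => true
  | _, EpsInf => true
  | EpsFin a n, EpsFin b m => a *+ m <= b *+ n
  | _, _ => false
  end.
Definition eps_max (x y : epsv) : epsv := if eps_le x y then y else x.

Definition eps_cand (f : {poly K}) (b : nat) : option epsv :=
  match nu f, nu (f^`N(b)) with
  | Some x, Some y => Some (EpsFin (x - y) b)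
  | _, _ => None
  end.

Definition eps_fin (f : {poly K}) : epsv :=
  foldr (fun b acc => match eps_cand f b with
                      | Some e => eps_max e acc
                      | None => acc end)
        EpsNInf (iota 1 (size f).-1).

Definition below_alpha (f : {poly K}) : Prop :=
  forall g, g != 0 -> nu g = None -> (size f < size g)%N.

Definition generates_supp (f : {poly K}) : Prop :=
  forall g, nu g = None <-> f %| g.

Definition is_eps (f : {poly K}) (e : epsv) : Prop :=
  f != 0 /\
  ( (size f = 1%N /\ e = EpsNInf)
  \/ (generates_supp f /\ e = EpsInf)
  \/ ((1 < size f)%N /\ below_alpha f /\ e = eps_fin f) ).

Definition key_poly (Q : {poly K}) : Prop :=
  Q \is monic /\ (exists eQ, is_eps Q eQ) /\
  forall f ef eQ, is_eps f ef -> is_eps Q eQ -> eps_le eQ ef ->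
    (size Q <= size f)%N.

End Defs.

(* Main.v *)
Require Import Defs.
From HB Require Import structures.
From mathcomp Require Import all_boot all_order all_algebra.
From mathcomp Require Import polyXY.
From Stdlib Require Import Classical.
Import Order.TTheory GRing.Theory Num.Theory.
Local Open Scope ring_scope.

(** Write f(x+y) in K[x][y]: the coefficient of y^b is the Hasse derivative of
    order b of f.  Give y the value e/n (denominators are cleared by replacing
    nu with n nu).  Then eps(f) compares with e/n according to where the Gauss
    valuation of f(x+y) reaches its minimum: eps(f) < e/n iff only at b = 0.
    Refining the Gauss valuation by the last index at which the minimum is
    reached keeps it multiplicative.  If p satisfies eps(h) < eps(p) = e/n for
    every h of smaller degree, and f = sum_i f_i p^i, then the terms
    f_i(x+y) p(x+y)^i have distinct refined values, so that of f(x+y) is the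
    least one.  Hence eps(f) <= eps(p) implies nu(f) = nu_p(f), and
    eps(f) < eps(p) implies nu(f - f mod p) > nu(f).

    If f/g witnesses transcendence, the products f^i g^(n-i) are valuation
    independent over K for every n.  No p of least degree can have
    eps(p) > eps(f), eps(g): reducing mod p would give deg p + 1 independent
    polynomials of degree < deg p.  So eps attains its maximum, and a monic
    polynomial Q of least degree attaining it is a key polynomial with
    nu = nu_Q.  When nu is not Krull, Q is the generator of the support.

    Conversely, if nu = nu_Q is Krull, either nu(Q) is not torsion modulo nu K,
    or nu(Q^m) = nu(c) and the residue of Q^m / c is transcendental. *)

Set Implicit Arguments. Unset Strict Implicit. Unset Printing Implicit Defensive.

(** * Ordered abelian groups and their extension by infinity *)

Section OrderedGroup.
Variables (G : porderZmodType) (HG : ordered_group G).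
Implicit Types (x y z : G) (a b c d : option G).

Definition vlt a b := ~~ vle b a.

Lemma og_leD x y z t : x <= y -> z <= t -> x + z <= y + t.
Proof.
case: HG => _ H xy zt; apply: le_trans (H _ _ z xy) _.
by rewrite ![y + _]addrC; apply: H.
Qed.

Lemma og_leD2r x y z : (x + z <= y + z) = (x <= y).
Proof.
apply/idP/idP => h; last exact: og_leD.
by rewrite -[x](addrK z) -[y](addrK z) og_leD.
Qed.

Lemma og_total x y : (x <= y) || (y <= x). Proof. by case: HG. Qed.

Lemma og_ltNge x y : (x < y) = ~~ (y <= x).
Proof.
rewrite lt_neqAle; have /orP[xy|yx] := og_total x y.
  rewrite xy andbT; congr negb; apply/eqP/idP => [->//|yx].
  by apply/le_anti; rewrite xy.
rewrite yx /=; apply/negP => /andP[/eqP ne xy]; case: ne.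
by apply/le_anti; rewrite xy.
Qed.

Lemma og_leMn n x y : x <= y -> x *+ n <= y *+ n.
Proof. by move=> xy; elim: n => [|n IH]; rewrite ?mulr0n // !mulrS og_leD. Qed.

Lemma og_ltD x y z t : x < y -> z <= t -> x + z < y + t.
Proof.
move=> xy zt; apply: (@lt_le_trans _ _ (y + z)); last by rewrite og_leD.
by rewrite og_ltNge og_leD2r -og_ltNge.
Qed.

Lemma og_leMn2r n x y : (0 < n)%N -> (x *+ n <= y *+ n) = (x <= y).
Proof.
case: n => // n _; apply/idP/idP => [|/og_leMn->//]; apply: contraTT.
by rewrite -!og_ltNge !mulrS => yx; rewrite og_ltD // og_leMn // ltW.
Qed.

Lemma og_eqMn2r n x y : (0 < n)%N -> x *+ n = y *+ n -> x = y.
Proof.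
by move=> n0 e; apply/le_anti; rewrite -(og_leMn2r x y n0) -(og_leMn2r y x n0) e lexx.
Qed.

Lemma vle_refl a : vle a a. Proof. by case: a => //= x. Qed.

Lemma vle_None a : vle a None. Proof. by case: a. Qed.

Lemma vle_trans b a c : vle a b -> vle b c -> vle a c.
Proof. by case: a b c => [x|] [y|] [z|] //=; apply: le_trans. Qed.

Lemma vle_total a b : vle a b || vle b a.
Proof. by case: a b => [x|] [y|] //=; apply: og_total. Qed.

Lemma vle_anti a b : vle a b -> vle b a -> a = b.
Proof.
by case: a b => [x|] [y|] //= h k; congr Some; apply/le_anti; rewrite h.
Qed.

Lemma vlt_SS x y : vlt (Some x) (Some y) = (x < y).
Proof. by rewrite og_ltNge. Qed.

Lemma vltW a b : vlt a b -> vle a b.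
Proof. by rewrite /vlt => /negPf h; have := vle_total a b; rewrite h orbF. Qed.

Lemma vleNgt a b : vle a b = ~~ vlt b a. Proof. by rewrite negbK. Qed.

Lemma vlt_irr a : vlt a a = false. Proof. by rewrite /vlt vle_refl. Qed.

Lemma vle_lt_trans b a c : vle a b -> vlt b c -> vlt a c.
Proof. by move=> ab; apply: contraNN => ca; apply: vle_trans ab. Qed.

Lemma vlt_le_trans b a c : vlt a b -> vle b c -> vlt a c.
Proof. by move=> ab bc; apply: contraNN ab; apply: vle_trans. Qed.

Lemma vle_eqVlt a b : vle a b -> a = b \/ vlt a b.
Proof.
move=> ab; case: (boolP (vle b a)) => [ba|]; last by right.
by left; apply: vle_anti.
Qed.

Lemma vaddC a b : vadd a b = vadd b a.
Proof. by case: a b => [x|] [y|] //=; rewrite addrC. Qed.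

Lemma vaddA a b c : vadd a (vadd b c) = vadd (vadd a b) c.
Proof. by case: a b c => [x|] [y|] [z|] //=; rewrite addrA. Qed.

Lemma vadd0 a : vadd (Some 0) a = a.
Proof. by case: a => //= x; rewrite add0r. Qed.

Lemma vaddACA a b c d :
  vadd (vadd a b) (vadd c d) = vadd (vadd a c) (vadd b d).
Proof. by rewrite -!vaddA; congr vadd; rewrite !vaddA (vaddC b). Qed.

Lemma vle_add a b c d : vle a b -> vle c d -> vle (vadd a c) (vadd b d).
Proof.
by case: a b c d => [x|] [y|] [z|] [t|] //=; apply: og_leD.
Qed.

Lemma vlt_add x b y d :
  vlt (Some x) b -> vle (Some y) d -> vlt (Some (x + y)) (vadd b d).
Proof.
by case: b d => [z|] [t|] //=; rewrite !vlt_SS; apply: og_ltD.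
Qed.

Lemma vle_add2l x a b : vle (vadd (Some x) a) (vadd (Some x) b) = vle a b.
Proof.
by case: a b => [y|] [z|] //=; rewrite ![x + _]addrC og_leD2r.
Qed.

Lemma vlt_add2l x a b : vlt (vadd (Some x) a) (vadd (Some x) b) = vlt a b.
Proof. by rewrite /vlt vle_add2l. Qed.

Lemma vle_vmin c a b : vle c (vmin a b) = vle c a && vle c b.
Proof.
rewrite /vmin; case: ifP => [ab|/negbT/vltW ba].
  by case: (boolP (vle c a)) => //= ca; rewrite (vle_trans ca).
by case: (boolP (vle c b)) => //= ca; rewrite ?(vle_trans ca) ?andbF.
Qed.

Lemma vlt_vmin c a b : vlt c a -> vlt c b -> vlt c (vmin a b).
Proof. by rewrite /vmin; case: ifP. Qed.

Definition vmuln (n : nat) a := omap (fun x => x *+ n) a.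

Lemma vmulnD n a b : vmuln n (vadd a b) = vadd (vmuln n a) (vmuln n b).
Proof. by case: a b => [x|] [y|] //=; rewrite mulrnDl. Qed.

Lemma vle_muln n a b : (0 < n)%N -> vle (vmuln n a) (vmuln n b) = vle a b.
Proof. by move=> n0; case: a b => [x|] [y|] //=; rewrite og_leMn2r. Qed.

Lemma vlt_muln n a b : (0 < n)%N -> vlt (vmuln n a) (vmuln n b) = vlt a b.
Proof. by move=> n0; rewrite /vlt vle_muln. Qed.

Lemma vmuln_inj n a b : (0 < n)%N -> vmuln n a = vmuln n b -> a = b.
Proof.
by move=> n0 e; apply: vle_anti; rewrite -(vle_muln _ _ n0) e vle_refl.
Qed.

Lemma big_vmin_le (N : nat) (F : nat -> option G) i :
  (i < N)%N -> vle (\big[@vmin G/None]_(i < N) F i) (F i).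
Proof.
move=> iN; have : Ordinal iN \in index_enum 'I_N by rewrite mem_index_enum.
elim: (index_enum _) => // j r IH; rewrite big_cons inE.
set m := vmin _ _; have : vle m m by exact: vle_refl.
rewrite {2}/m vle_vmin => /andP[mi mr] /orP[/eqP e|/IH].
  by rewrite -e in mi.
exact: vle_trans mr.
Qed.
Lemma big_vmin_eq (N : nat) (F : nat -> option G) c (s : nat) :
  (s < N)%N -> F s = c -> (forall i, (i < N)%N -> vle c (F i)) ->
  \big[@vmin G/None]_(i < N) F i = c.
Proof.
move=> sN <- cF; apply: vle_anti; first exact: big_vmin_le.
elim/big_ind: _ => [|a b|i _]; rewrite ?vle_None ?vle_vmin //; last exact: cF.
by move=> -> ->.
Qed.

(** Induction on [N]: the new index replaces the current one as soon as its value is at most the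
    current minimum, so ties go to the later index. *)
Lemma last_argmin (T : nat -> option G) N :
  (exists2 i, (i < N)%N & T i <> None) ->
  exists s x, [/\ (s < N)%N, T s = Some x,
    forall i, (i < N)%N -> vle (Some x) (T i)
    & forall i, (i < N)%N -> (s < i)%N -> vlt (Some x) (T i)].
Proof.
elim: N => [|N IH] [j jN Tj]; first by [].
case: (classic (exists2 i, (i < N)%N & T i <> None)) => [/IH|none].
  move=> [s [x [sN Ts l g]]]; case: (boolP (vle (T N) (Some x))) => [h|h].
    case TN : (T N) h => [y|//] h.
    exists N, y; split=> // i; rewrite ltnS leq_eqVlt => /orP[/eqP->|iN].
    - by rewrite TN vle_refl.
    - exact: vle_trans h (l _ iN).
    - by rewrite ltnn.
    - by move=> Ni; rewrite ltnNge ltnW in Ni.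
  exists s, x; split=> // [|i|i]; rewrite ltnS leq_eqVlt.
  - by rewrite sN orbT.
  - by move=> /orP[/eqP->|/l//]; apply: vltW.
  - by move=> /orP[/eqP->|/g//].
have TiN i : (i < N)%N -> T i = None.
  by move=> iN; case e : (T i) => [x|//]; case: none; exists i => //; rewrite e.
move: jN; rewrite ltnS leq_eqVlt => /orP[/eqP jN|/TiN//].
case TN : (T N) => [x|]; last by rewrite jN in Tj.
exists N, x; split=> // i; rewrite ltnS leq_eqVlt => /orP[/eqP->|iN].
- by rewrite TN vle_refl.
- by rewrite TiN.
- by rewrite ltnn.
- by rewrite TiN.
Qed.
End OrderedGroup.

Arguments vle {G} a b : simpl nomatch.
Arguments vadd {G} a b : simpl nomatch.

(** * Elementary properties of valuations on K[x] *)

Section Valuation.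
Variables (K : fieldType) (G : porderZmodType) (HG : ordered_group G).
Variables (nu : {poly K} -> option G) (Hnu : valuation nu).
Implicit Types (f g h a b : {poly K}) (x y : G) (c : option G).

Lemma nuM a b : nu (a * b) = vadd (nu a) (nu b). Proof. by case: Hnu. Qed.
Lemma nu1 : nu 1 = Some 0. Proof. by case: Hnu => _ [_ []]. Qed.
Lemma nu0 : nu 0 = None. Proof. by case: Hnu => _ [_ []]. Qed.

Lemma nu_leD c a b : vle c (nu a) -> vle c (nu b) -> vle c (nu (a + b)).
Proof.
move=> ca cb; case: Hnu => _ [/(_ a b) h _]; apply: vle_trans h.
by rewrite vle_vmin // ca.
Qed.

Lemma nu_ltD c a b : vlt c (nu a) -> vlt c (nu b) -> vlt c (nu (a + b)).
Proof.
move=> ca cb; case: Hnu => _ [/(_ a b) h _]; apply: vlt_le_trans h.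
exact: vlt_vmin.
Qed.

Lemma nu_le_sum (I : finType) (P : pred I) (F : I -> {poly K}) c :
  (forall i, P i -> vle c (nu (F i))) -> vle c (nu (\sum_(i | P i) F i)).
Proof.
move=> h; elim/big_ind: _ => // [|a b]; rewrite ?nu0 ?vle_None //.
exact: nu_leD.
Qed.

Lemma nu_lt_sum (I : finType) (P : pred I) (F : I -> {poly K}) x :
  (forall i, P i -> vlt (Some x) (nu (F i))) ->
  vlt (Some x) (nu (\sum_(i | P i) F i)).
Proof.
by move=> h; elim/big_ind: _ => // [|a b]; rewrite ?nu0 //; apply: nu_ltD.
Qed.

(** Twice the value of -1 is the value of 1, and an ordered group has no torsion. *)
Lemma nuN f : nu (- f) = nu f.
Proof.
suff e : nu (-1) = Some 0 by rewrite -mulN1r nuM e vadd0.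
have := nuM (-1) (-1); rewrite mulrNN mulr1 nu1.
case: (nu (-1)) => //= x [] e; congr Some.
by apply: (og_eqMn2r HG (n := 2)); rewrite // mulr2n -e mul0rn.
Qed.

(** Otherwise [a], as the sum of [a + b] and [- b], would have a value larger than its own. *)
Lemma nuD_eq a b : vlt (nu a) (nu b) -> nu (a + b) = nu a.
Proof.
move=> ab; apply: vle_anti; last first.
  by apply: nu_leD; [exact: vle_refl | exact: vltW].
rewrite vleNgt; apply/negP => h.
suff : vlt (nu a) (nu (a + b - b)) by rewrite addrK vlt_irr.
by apply: nu_ltD; rewrite ?nuN.
Qed.

Lemma nuX f x n : nu f = Some x -> nu (f ^+ n) = Some (x *+ n).
Proof.
by move=> fx; elim: n => [|n IH]; rewrite ?expr0 ?nu1 // exprS nuM IH fx mulrS.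
Qed.

Lemma nuC_Some (k : K) : k != 0 -> exists x, nu k%:P = Some x.
Proof.
move=> k0; have := nuM k%:P k^-1%:P; rewrite -polyCM divff // nu1.
by case: (nu k%:P) => //= x; exists x.
Qed.

Lemma nuC_inv (k : K) x : k != 0 -> nu k%:P = Some x -> nu k^-1%:P = Some (- x).
Proof.
move=> k0 kx; have := nuM k%:P k^-1%:P; rewrite -polyCM divff // nu1 kx.
case: (nu _) => //= z [] /eqP; rewrite eq_sym addr_eq0 => /eqP ->.
by rewrite opprK.
Qed.

(** For n nu the slope e/n becomes the element e of [G], so that the tensor product with Q is
    avoided. *)
Definition scaled n f := vmuln n (nu f).

Lemma scaled_valuation n : (0 < n)%N -> valuation (scaled n).
Proof.
move=> n0; rewrite /scaled; split=> [a b|]; first by rewrite nuM vmulnD.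
rewrite nu1 nu0 /= mul0rn; split=> // a b; case: Hnu => _ [/(_ a b) h _].
by move: h; rewrite /vmin vle_muln //; case: ifP => _ h; rewrite vle_muln.
Qed.

End Valuation.

(** * The polynomial f(x+y) and Hasse derivatives *)

Section Taylor.
Variable K : fieldType.
Implicit Types f g : {poly K}.

(** Taylor's formula at the constant x of K[x][y] with increment y; evaluating a Hasse derivative of
    [f] at x gives it back. *)
Lemma coef_poly_XaY f b : (poly_XaY f)`_b = f^`N(b).
Proof.
have -> : poly_XaY f = \sum_(i < size f) f^`N(i) *: 'X^i.
  rewrite /poly_XaY addrC /comp_poly nderiv_taylor; last exact: mulrC.
  rewrite !size_map_inj_poly ?raddf0 //; [|exact: polyC_inj..].
  apply: eq_bigr => i _; rewrite -mul_polyC; congr (_ * _).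
  by rewrite !nderivn_map horner_map -[_.['X]]/(_ \Po 'X) comp_polyXr.
rewrite -(poly_def _ (fun i => f^`N(i))) coef_poly; case: ltnP => // h.
by rewrite nderivn_poly0.
Qed.

Lemma poly_XaYD f g : poly_XaY (f + g) = poly_XaY f + poly_XaY g.
Proof. by rewrite /poly_XaY rmorphD /= comp_polyD. Qed.

Lemma poly_XaYM f g : poly_XaY (f * g) = poly_XaY f * poly_XaY g.
Proof. by rewrite /poly_XaY rmorphM /= comp_polyM. Qed.

Lemma poly_XaYX f n : poly_XaY (f ^+ n) = poly_XaY f ^+ n.
Proof.
elim: n => [|n IH]; last by rewrite !exprS poly_XaYM IH.
by rewrite !expr0 /poly_XaY rmorph1 comp_polyC.
Qed.

Lemma poly_XaY_sum (I : Type) (r : seq I) (P : pred I) (F : I -> {poly K}) :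
  poly_XaY (\sum_(i <- r | P i) F i) = \sum_(i <- r | P i) poly_XaY (F i).
Proof. by apply: big_morph; [exact: poly_XaYD | exact: poly_XaY0]. Qed.
End Taylor.

(** * The Gauss valuation refined by the last minimal index *)

Section LeadingWeight.
Variables (K : fieldType) (G : porderZmodType) (HG : ordered_group G).
Variables (mu : {poly K} -> option G) (Hmu : valuation mu) (e : G).
Implicit Types (F : {poly {poly K}}) (x y : G).

Definition wt F b := vadd (mu F`_b) (Some (e *+ b)).

(* The Gauss valuation of F with y given the value e is x, and B is the last
   index at which the minimum is reached. *)
Definition lead F x B :=
  [/\ forall b, vle (Some x) (wt F b),
      forall b, (B < b)%N -> vlt (Some x) (wt F b)
    & wt F B = Some x].

Lemma vle_shift (a : option G) x y :
  vle (Some x) (vadd a (Some y)) = vle (Some (x - y)) a.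
Proof. by case: a => //= z; rewrite -(og_leD2r HG (x - y) z y) subrK. Qed.

Lemma vlt_shift (a : option G) x y :
  vlt (Some x) (vadd a (Some y)) = vlt (Some (x - y)) a.
Proof.
case: a => //= z; rewrite !vlt_SS // !og_ltNge //.
by rewrite -(og_leD2r HG z (x - y) y) subrK.
Qed.

Lemma wtM F F' j k : (j <= k)%N ->
  vadd (mu (F`_j * F'`_(k - j))) (Some (e *+ k)) = vadd (wt F j) (wt F' (k - j)).
Proof.
by move=> jk; rewrite nuM // /wt vaddACA /= -mulrnDr subnKC.
Qed.

Lemma lead_uniq F x y B C : lead F x B -> lead F y C -> x = y /\ B = C.
Proof.
move=> [l1 g1 e1] [l2 g2 e2].
have xy : x = y by apply: Some_inj; apply: vle_anti; [rewrite -e2|rewrite -e1].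
split=> //; case: (ltngtP B C) => // h.
  by have := g1 _ h; rewrite e2 xy vlt_irr.
by have := g2 _ h; rewrite e1 xy vlt_irr.
Qed.

(** In a coefficient of index k >= B + C, every pair (j, k - j) other than (B, C) has j > B or k - j
    > C, hence contributes strictly more than x + y. At B + C the single pair (B, C) decides the
    value. *)
Lemma lead_mul F F' x y B C :
  lead F x B -> lead F' y C -> lead (F * F') (x + y) (B + C).
Proof.
move=> [l1 g1 e1] [l2 g2 e2].
have gt k j : (j <= k)%N -> (B < j)%N || (C < k - j)%N ->
    vlt (Some (x + y - e *+ k)) (mu (F`_j * F'`_(k - j))).
  move=> jk /orP h; rewrite -vlt_shift wtM //; case: h => h.
    by apply: vlt_add => //; apply: g1.
  by rewrite addrC vaddC; apply: vlt_add => //; apply: g2.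
split=> [k|k Bk|].
- rewrite /wt vle_shift coefM; apply: nu_le_sum => // -[j /= jk] _.
  by rewrite -vle_shift wtM //; apply: (@vle_add _ HG (Some x) _ (Some y)).
- rewrite /wt vlt_shift coefM; apply: nu_lt_sum => // -[j /= jk] _.
  apply: gt => //; case: (ltnP B j) => //= jB.
  by rewrite ltn_subRL; apply: leq_ltn_trans Bk; rewrite leq_add2r.
- have BC : (B < (B + C).+1)%N by rewrite ltnS leq_addr.
  rewrite /wt coefM (bigD1 (Ordinal BC)) //= nuD_eq //; last first.
    have := wtM F F' (leq_addr C B); rewrite addKn e1 e2 /= => h.
    have -> : mu (F`_B * F'`_C) = Some (x + y - e *+ (B + C)).
      by case: (mu _) h => //= z [<-]; rewrite addrK.
    apply: nu_lt_sum => // -[j /= jk]; rewrite -val_eqE /= => jB.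
    apply: gt => //; case: ltngtP jB => //= jB _.
    by rewrite ltn_subRL addnC; rewrite addnC ltn_add2r.
  by have := wtM F F' (leq_addr C B); rewrite addKn e1 e2.
Qed.

Lemma lead_exp F x B n : lead F x B -> lead (F ^+ n) (x *+ n) (B * n).
Proof.
move=> lF; elim: n => [|n IH].
  split=> [b|b b0|]; rewrite expr0 /wt coef1 ?muln0 /= ?nu1 //= ?mulr0n ?addr0 //.
    by case: b => [|b] /=; rewrite ?nu0 ?nu1 //= ?mulr0n ?addr0.
  by case: b b0 => // b _; rewrite nu0.
by rewrite exprS mulrS mulnS; apply: lead_mul.
Qed.

(** The other summands may reach the minimum, but only before index [B]; they can neither cancel the
    coefficient at [B] nor move the last minimal index. *)
Lemma lead_sum (I : finType) (F : I -> {poly {poly K}}) x B s :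
  lead (F s) x B ->
  (forall i, i != s -> (forall b, vle (Some x) (wt (F i) b)) /\
     forall b, (B <= b)%N -> vlt (Some x) (wt (F i) b)) ->
  lead (\sum_i F i) x B.
Proof.
move=> [l1 g1 e1] h; split=> [b|b Bb|].
- rewrite /wt vle_shift coef_sum; apply: nu_le_sum => // i _.
  by rewrite -vle_shift; have [->|/h[l _]] := eqVneq i s; [apply: l1 | apply: l].
- rewrite /wt vlt_shift coef_sum; apply: nu_lt_sum => // i _; rewrite -vlt_shift.
  by have [->|/h[_]] := eqVneq i s; [apply: g1 | apply; apply: ltnW].
- rewrite /wt coef_sum (bigD1 s) //= nuD_eq //.
  have -> : mu (F s)`_B = Some (x - e *+ B).
    by move: e1; rewrite /wt; case: (mu _) => //= z [<-]; rewrite addrK.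
  by apply: nu_lt_sum => // i /h[_]; rewrite -vlt_shift; apply.
Qed.
End LeadingWeight.

(** * Expansions in powers of a polynomial *)

Section Expansion.
Variable K : fieldType.
Implicit Types f p q : {poly K}.

Lemma size_qcoef p f i : p != 0 -> (size (qcoef p f i) < size p)%N.
Proof. by rewrite ltn_modp. Qed.

(** Repeated division by [p] leaves the term [f %/ p ^+ N * p ^+ N], which vanishes at N = [size f]
    because then deg(p^N) >= N > deg(f). *)
Lemma qexpansion p f : (1 < size p)%N ->
  f = \sum_(i < size f) qcoef p f i * p ^+ i.
Proof.
move=> p1; have p0 : p != 0 by rewrite -size_poly_gt0 ltnW.
have H N : f = \sum_(i < N) qcoef p f i * p ^+ i + f %/ p ^+ N * p ^+ N.
  elim: N => [|N IH]; first by rewrite big_ord0 add0r expr0 divp1 mulr1.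
  rewrite {1}IH big_ord_recr /= -addrA; congr (_ + _).
  rewrite {1}(divp_eq (f %/ p ^+ N) p) divp_divl -exprSr mulrDl addrC.
  by congr (_ + _); rewrite -mulrA -exprS.
rewrite {1}(H (size f)) [f %/ _]divp_small ?mul0r ?addr0 //.
rewrite (polySpred (expf_neq0 _ p0)) size_exp ltnS leq_pmull //.
by case: (size p) p1 => [|[|k]].
Qed.
End Expansion.

(** * Epsilon and the leading terms of expansions *)

Section Truncation.
Variables (K : fieldType) (G : porderZmodType) (HG : ordered_group G).
Variables (mu : {poly K} -> option G) (Hmu : valuation mu) (Hk : krull mu).
Variable e : G.
Implicit Types (f g h p : {poly K}) (x y : G).

(** The inequality eps(f) <= e with its denominators cleared: mu(f) <= mu(d_b f) + b e for every b,
    where d_b is the Hasse derivative. [eps_below] is the strict version. *)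
Definition eps_at_most f := forall b, vle (mu f) (wt mu e (poly_XaY f) b).
Definition eps_below f :=
  forall b, (0 < b)%N -> vlt (mu f) (wt mu e (poly_XaY f) b).

Lemma krull_Some f : f != 0 -> exists x, mu f = Some x.
Proof. by case E : (mu f) => [x|] f0; [exists x | rewrite (Hk E) eqxx in f0]. Qed.

Lemma wt_XaY0 f : wt mu e (poly_XaY f) 0 = mu f.
Proof. by rewrite /wt coef_poly_XaY nderivn0 mulr0n vaddC vadd0. Qed.

Lemma eps_below_lead f x : mu f = Some x -> eps_below f ->
  lead mu e (poly_XaY f) x 0.
Proof.
move=> fx h; split=> [[|b]|b b0|]; rewrite ?wt_XaY0 ?fx ?vle_refl // -fx.
  by apply: vltW => //; apply: h.
exact: h.
Qed.

Lemma lead_eps_below f x : lead mu e (poly_XaY f) x 0 -> eps_below f.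
Proof. by move=> [_ g]; rewrite wt_XaY0 => fx b b0; rewrite fx; apply: g. Qed.

(** * Expansions along a polynomial whose epsilon exceeds all those of smaller degree *)

Section KeyLike.
Variables (p : {poly K}) (v : G) (B : nat).
Hypotheses (p1 : (1 < size p)%N) (B0 : (0 < B)%N).
Hypothesis lp : lead mu e (poly_XaY p) v B.
Hypothesis pv : mu p = Some v.
Hypothesis minp : forall h, h != 0 -> (size h < size p)%N -> eps_below h.

(** By multiplicativity, [h] contributes the index 0 and p^i the index B i; since B > 0, distinct
    powers of [p] lead at distinct indices. *)
Lemma lead_term h i : h != 0 -> (size h < size p)%N ->
  exists2 y, mu (h * p ^+ i) = Some y & lead mu e (poly_XaY (h * p ^+ i)) y (B * i).
Proof.
move=> h0 hp; have [x hx] := krull_Some h0; exists (x + v *+ i).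
  by rewrite nuM // hx (nuX Hmu _ pv).
rewrite poly_XaYM poly_XaYX; apply: (@lead_mul _ _ HG _ Hmu _ _ _ _ _ 0).
  by apply: eps_below_lead => //; apply: minp.
exact: lead_exp.
Qed.

(** Let [s] be the last index at which the terms of the expansion have minimal value. Terms after
    [s] are strictly larger, and a term before [s] leads at B i < B s, so [lead_sum] applies. *)
Lemma lead_expansion f : f != 0 -> exists s x,
  [/\ (s < size f)%N, mu (qcoef p f s * p ^+ s) = Some x,
     forall i, (i < size f)%N -> vle (Some x) (mu (qcoef p f i * p ^+ i)),
     forall i, (i < size f)%N -> (s < i)%N ->
       vlt (Some x) (mu (qcoef p f i * p ^+ i))
   & lead mu e (poly_XaY f) x (B * s)].
Proof.
move=> f0; have p0 : p != 0 by rewrite -size_poly_gt0 ltnW.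
case: (@last_argmin _ HG (fun i => mu (qcoef p f i * p ^+ i)) (size f)).
  apply: NNPP => none; move/eqP: f0; apply; rewrite (qexpansion f p1).
  rewrite big1 // => i _; apply: Hk; apply: NNPP => h; apply: none.
  by exists (nat_of_ord i).
move=> s [x [sN sx l g]]; exists s, x; split=> //.
rewrite {1}(qexpansion f p1) poly_XaY_sum.
apply: (@lead_sum _ _ HG _ Hmu _ _ _ _ _ (Ordinal sN)) => /=.
  have [|y] := @lead_term (qcoef p f s) s _ (size_qcoef f s p0).
    by apply/negP => /eqP q0; move: sx; rewrite q0 mul0r nu0.
  by rewrite sx => -[->].
move=> [i iN]; rewrite -val_eqE /= => is_.
have [->|q0] := eqVneq (qcoef p f i) 0.
  by rewrite mul0r poly_XaY0; split=> b; rewrite /wt coef0 nu0.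
have [y iy [ly gy _]] := lead_term i q0 (size_qcoef f i p0).
have xy : vle (Some x) (Some y) by rewrite -iy; apply: l.
split=> b; first exact: vle_trans (ly b).
move=> sb; case: (ltngtP i s) is_ => // h _.
  apply: vle_lt_trans xy (gy _ _); apply: leq_trans sb.
  by rewrite ltn_mul2l B0.
by apply: vlt_le_trans (ly b); rewrite -iy; apply: g.
Qed.

(** Here f(x+y) leads at index 0, so B s = 0 and s = 0: the remainder is the only term of minimal
    value. *)
Lemma eps_below_modp f : f != 0 -> eps_below f -> vlt (mu f) (mu (f - f %% p)).
Proof.
move=> f0 fe; have [s [x [sN sx l g lf]]] := lead_expansion f0.
have [y fy] := krull_Some f0.
have [xy /eqP] := lead_uniq lf (eps_below_lead fy fe).
rewrite muln_eq0 -leqn0 leqNgt B0 /= => /eqP s0; subst s y.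
rewrite {2}(qexpansion f p1) (bigD1 (Ordinal sN)) //= {1}/qcoef.
rewrite expr0 divp1 mulr1 addrAC subrr add0r fy.
apply: nu_lt_sum => // -[i iN]; rewrite -val_eqE /= -lt0n; exact: g.
Qed.

(** The Gauss value of f(x+y) is the least value of the terms; it is at most mu(f) by the index 0,
    and at least mu(f) by the bound on epsilon. *)
Lemma eps_at_most_expansion f : f != 0 -> eps_at_most f -> exists s,
  [/\ (s < size f)%N, mu (qcoef p f s * p ^+ s) = mu f
   & forall i, (i < size f)%N -> vle (mu f) (mu (qcoef p f i * p ^+ i))].
Proof.
move=> f0 fe; have [s [x [sN sx l g [lf _ ef]]]] := lead_expansion f0.
suff -> : mu f = Some x by exists s.
by apply: vle_anti; [rewrite -ef; apply: fe | rewrite -wt_XaY0; apply: lf].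
Qed.
End KeyLike.
End Truncation.

(** * The invariant epsilon of a Krull valuation *)

Section Epsilon.
Variables (K : fieldType) (G : porderZmodType) (HG : ordered_group G).
Variables (nu : {poly K} -> option G) (Hnu : valuation nu) (Hk : krull nu).
Implicit Types (f g h p : {poly K}) (x y e : G) (u v w : epsv G).

Lemma scaled_krull n : krull (scaled nu n).
Proof. by move=> f; rewrite /scaled; case E : (nu f) => //= _; apply: Hk. Qed.

(** [eps_le] compares fractions by cross-multiplication; transitivity cancels the middle
    denominator, which must therefore be positive. *)
Definition eps_denom_pos u := if u is EpsFin _ n then (0 < n)%N else true.

Lemma eps_le_trans v u w :
  eps_denom_pos v -> eps_le u v -> eps_le v w -> eps_le u w.
Proof.
case: v u w => [|b m|] [|a n|] [|c k|] //= m0 h1 h2.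
rewrite -(og_leMn2r HG _ _ m0) -mulrnA mulnC mulrnA.
apply: le_trans (og_leMn HG k h1) _; rewrite -mulrnA mulnC mulrnA.
by rewrite -[c *+ n *+ m]mulrnA [(n * m)%N]mulnC [c *+ _]mulrnA og_leMn.
Qed.

Lemma eps_le_total u v : eps_le u v || eps_le v u.
Proof. by case: u v => [|b m|] [|a n|] //=; apply: og_total. Qed.

Lemma eps_le_refl u : eps_le u u.
Proof. by have := eps_le_total u u; rewrite orbb. Qed.

Lemma eps_foldr f x (s : seq nat) :
  nu f = Some x -> (forall b, b \in s -> (0 < b)%N) ->
  let E := foldr (fun b acc => match eps_cand nu f b with
                      | Some e => eps_max e acc
                      | None => acc end) (EpsNInf G) s in
  (E = EpsNInf G /\ forall b, b \in s -> nu f^`N(b) = None) \/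
  exists b y, [/\ b \in s, nu f^`N(b) = Some y, E = EpsFin (x - y) b
    & forall b' y', b' \in s -> nu f^`N(b') = Some y' ->
        eps_le (EpsFin (x - y') b') E].
Proof.
move=> fx; elim: s => [|c s IH] pos E; first by left.
have pos' b : b \in s -> (0 < b)%N by move=> bs; apply: pos; rewrite inE bs orbT.
have c0 : (0 < c)%N by apply: pos; rewrite inE eqxx.
have cand : eps_cand nu f c =
    if nu f^`N(c) is Some y then Some (EpsFin (x - y) c) else None.
  by rewrite /eps_cand fx.
rewrite {}/E /= cand; case cy : (nu f^`N(c)) => [z|]; last first.
  case: (IH pos') => [[-> h]|[b [y [bs by_ -> h]]]].
    by left; split=> // b; rewrite inE => /orP[/eqP->//|/h].
  right; exists b, y; split=> //; first by rewrite inE bs orbT.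
  by move=> b' y'; rewrite inE => /orP[/eqP->|bs']; last exact: h; rewrite cy.
right; case: (IH pos') => [[-> h]|[b [y [bs by_ -> h]]]].
  exists c, z; split=> //; first by rewrite inE eqxx.
  move=> b' y'; rewrite inE => /orP[/eqP->|/h->//]; rewrite cy => -[->].
  exact: (eps_le_refl (EpsFin (x - y') c)).
rewrite /eps_max; case: ifP => [cb|/negbT cb].
  exists b, y; split=> //; first by rewrite inE bs orbT.
  by move=> b' y'; rewrite inE => /orP[/eqP->|bs']; last exact: h; rewrite cy => -[<-].
exists c, z; split=> //; first by rewrite inE eqxx.
move=> b' y'; rewrite inE => /orP[/eqP->|/h h'].
  by rewrite cy => -[->]; apply: (eps_le_refl (EpsFin (x - y') c)).
move=> /h' h''.
apply: (@eps_le_trans (EpsFin (x - y) b) (EpsFin (x - y') b') (EpsFin (x - z) c)) h'' _.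
  exact: pos'.
by have := eps_le_total (EpsFin (x - z) c) (EpsFin (x - y) b); rewrite (negPf cb).
Qed.

Lemma eps_fin_const f : (size f <= 1)%N -> eps_fin nu f = EpsNInf G.
Proof. by rewrite /eps_fin; case: (size f) => [|[|]]. Qed.

Lemma eps_fin_attained f : (1 < size f)%N -> exists x b y,
  [/\ nu f = Some x, (0 < b)%N, nu f^`N(b) = Some y,
     eps_fin nu f = EpsFin (x - y) b
   & forall b' y', (0 < b')%N -> nu f^`N(b') = Some y' ->
       (x - y') *+ b <= (x - y) *+ b'].
Proof.
move=> f1; have f0 : f != 0 by rewrite -size_poly_gt0 ltnW.
have [x fx] := krull_Some Hk f0.
have pos b : b \in iota 1 (size f).-1 -> (0 < b)%N by rewrite mem_iota => /andP[].
have := eps_foldr fx pos; rewrite -/(eps_fin nu f) /=.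
case=> [[_ h]|[b [y [bs by_ E h]]]].
  (* The derivative of order deg f is the nonzero leading coefficient of [f], so at least one
     candidate exists. *)
  have /h/Hk/(congr1 (fun q : {poly K} => q`_0)) : (size f).-1 \in iota 1 (size f).-1.
    by rewrite mem_iota add1n leqnn andbT; case: (size f) f1 => [|[]].
  rewrite coef_nderivn addn0 binn mulr1n coef0 => /eqP.
  by rewrite -[_`__]/(lead_coef f) lead_coef_eq0 (negPf f0).
exists x, b, y; split=> // [|b' y' b'0 fy]; first exact: pos.
have := h b' y'; rewrite E /=; apply=> //.
rewrite mem_iota b'0 add1n; case: ltnP => //= fb.
by move: fy; rewrite nderivn_poly0 ?nu0 //; case: (size f) f1 fb.
Qed.

Lemma eps_fin_pos f : eps_denom_pos (eps_fin nu f).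
Proof.
case: (leqP (size f) 1) => [/eps_fin_const->//|].
by case/eps_fin_attained=> x [b [y [_ b0 _ -> _]]].
Qed.

Lemma nderivn_const f b : (size f <= 1)%N -> (0 < b)%N -> f^`N(b) = 0.
Proof. by move=> f1 b0; rewrite nderivn_poly0 // (leq_trans f1). Qed.

Lemma og_subMn_le x y e n b : ((x - y) *+ n <= e *+ b) = (x *+ n <= y *+ n + e *+ b).
Proof. by rewrite -(og_leD2r HG _ _ (y *+ n)) mulrnBl subrK addrC. Qed.

(** By maximality the bound e/n passes to every index; conversely the index attaining the maximum
    suffices. *)
Lemma eps_le_at_most f e n : (0 < n)%N -> f != 0 ->
  eps_le (eps_fin nu f) (EpsFin e n) <-> eps_at_most (scaled nu n) e f.
Proof.
move=> n0 f0; have [x fx] := krull_Some Hk f0.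
rewrite /eps_at_most /wt; split=> [le b|h].
  rewrite coef_poly_XaY; case: b => [|b].
    by rewrite nderivn0 mulr0n vaddC vadd0 vle_refl.
  case: (leqP (size f) 1) => f1; first by rewrite nderivn_const // /scaled nu0 // vle_None.
  case: (eps_fin_attained f1) le => x' [c [y [fx' c0 cy -> max]]] /= le.
  rewrite /scaled fx; case by_ : (nu _) => [z|] //=.
  move: fx'; rewrite fx => -[?]; subst x'.
  have {}max := max b.+1 z isT by_.
  have := @eps_le_trans (EpsFin (x - y) c) (EpsFin (x - z) b.+1) (EpsFin e n) c0 max le.
  by rewrite /= og_subMn_le.
case: (leqP (size f) 1) => f1; first by rewrite eps_fin_const.
case: (eps_fin_attained f1) => x' [c [y [fx' c0 cy -> max]]] /=.
move: fx'; rewrite fx => -[?]; subst x'.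
by have := h c; rewrite coef_poly_XaY /scaled fx cy /= og_subMn_le.
Qed.

Lemma eps_lt_below f e n : (0 < n)%N -> f != 0 ->
  ~~ eps_le (EpsFin e n) (eps_fin nu f) -> eps_below (scaled nu n) e f.
Proof.
move=> n0 f0 lt b b0; have [x fx] := krull_Some Hk f0.
rewrite /wt coef_poly_XaY.
case: (leqP (size f) 1) => f1.
  by rewrite nderivn_const // /scaled nu0 // fx.
case: (eps_fin_attained f1) lt => x' [c [y [fx' c0 cy -> max]]] lt.
rewrite /scaled fx; case by_ : (nu _) => [z|] //=.
move: fx'; rewrite fx => -[?]; subst x'.
rewrite vlt_SS // og_ltNge //; apply: contraNN lt => h.
apply: (@eps_le_trans (EpsFin (x - z) b)) => //=.
  by rewrite -(og_leD2r HG _ _ (z *+ n)) addrC mulrnBl subrK.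
exact: max.
Qed.

(** The order [n] attaining eps(f) = e/n is also its denominator. The weight at [n] equals the
    minimal weight, that of index 0, so the last minimal index [B] is at least n > 0. *)
Lemma eps_fin_key f : (1 < size f)%N -> exists (e : G) (n B : nat) (v : G),
  [/\ eps_fin nu f = EpsFin e n, (0 < n)%N, (0 < B)%N, scaled nu n f = Some v
   & lead (scaled nu n) e (poly_XaY f) v B].
Proof.
move=> f1; have [x [n [y [fx n0 ny E max]]]] := eps_fin_attained f1.
have f0 : f != 0 by rewrite -size_poly_gt0 ltnW.
set e := x - y in E *; have fv : scaled nu n f = Some (x *+ n) by rewrite /scaled fx.
have atn : wt (scaled nu n) e (poly_XaY f) n = Some (x *+ n).
  by rewrite /wt coef_poly_XaY /scaled ny /= -mulrnDl addrC subrK.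
have lef : eps_at_most (scaled nu n) e f.
  by apply/eps_le_at_most; rewrite // E eps_le_refl.
have nN : (n < size f)%N.
  by rewrite ltnNge; apply/negP => h; rewrite nderivn_poly0 // nu0 in ny.
case: (@last_argmin _ HG (wt (scaled nu n) e (poly_XaY f)) (size f)).
  by exists n => //; rewrite atn.
move=> B [v [BN Bv l g]].
have vx : v = x *+ n.
  by apply: Some_inj; apply: vle_anti; [rewrite -atn; apply: l | rewrite -Bv -fv].
subst v; exists e, n, B, (x *+ n); split=> //.
  rewrite (leq_trans n0) // leqNgt; apply/negP => /(g _ nN).
  by rewrite atn vlt_irr.
split=> // [b|b Bb]; first by rewrite -fv.
case: (ltnP b (size f)) => [/g->//|fb].
by rewrite /wt coef_poly_XaY nderivn_poly0 // /scaled nu0.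
Qed.

Lemma nu_scale (k : K) f : nu (k *: f) = vadd (nu k%:P) (nu f).
Proof. by rewrite -mul_polyC nuM. Qed.

Lemma eps_at_most_shift f g x e n :
  (forall b, nu g^`N(b) = vadd (Some x) (nu f^`N(b))) ->
  eps_at_most (scaled nu n) e g -> eps_at_most (scaled nu n) e f.
Proof.
move=> E h b; have := E 0%N; rewrite (nderivn0 f) (nderivn0 g) => E0.
have : vle (scaled nu n g) (vadd (scaled nu n g^`N(b)) (Some (e *+ b))).
  by rewrite -coef_poly_XaY; apply: h.
rewrite /wt coef_poly_XaY /scaled E0 E.
by rewrite 2!vmulnD -vaddA vle_add2l.
Qed.

(** Multiplication by [k] adds nu(k) to the values of all Hasse derivatives alike. This allows a
    polynomial to be made monic. *)
Lemma eps_fin_scale (k : K) f : k != 0 -> (1 < size f)%N ->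
  eps_le (eps_fin nu f) (eps_fin nu (k *: f)).
Proof.
move=> k0 f1; have f0 : f != 0 by rewrite -size_poly_gt0 ltnW.
have [|e [n [B [x' [E n0 _ _ _]]]]] := @eps_fin_key (k *: f).
  by rewrite size_scale.
have [x kx] := nuC_Some Hnu k0.
rewrite E; apply/eps_le_at_most => //.
apply: (@eps_at_most_shift f (k *: f) x) => [b|].
  by rewrite -kx -nu_scale; congr nu; exact: nderivnZ.
apply/eps_le_at_most; rewrite ?E ?eps_le_refl //.
by rewrite scaler_eq0 negb_or k0 f0.
Qed.
End Epsilon.

(** * Valuation independence from transcendence *)

Section ValuationIndependence.
Variables (K : fieldType) (G : porderZmodType) (HG : ordered_group G).
Variables (nu : {poly K} -> option G) (Hnu : valuation nu) (Hk : krull nu).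
Implicit Types (f g h p : {poly K}).

(** Homogeneous form of the valuation independence over K of the powers of f/g: multiplying by g^n
    keeps the combinations inside K[x]. *)
Definition val_indep f g := forall n (c : 'I_n.+1 -> K),
  (exists i, c i != 0) ->
  exists k, [/\ c k != 0,
    forall i, vle (nu (c k *: (f ^+ k * g ^+ (n - k))))
                  (nu (c i *: (f ^+ i * g ^+ (n - i))))
    & nu (\sum_i c i *: (f ^+ i * g ^+ (n - i)))
      = nu (c k *: (f ^+ k * g ^+ (n - k)))].

(** The matrix of coefficients has n + 1 rows and n columns, so its left kernel is nonzero. *)
Lemma poly_family_dep n (r : 'I_n.+1 -> {poly K}) :
  (forall i, (size (r i) <= n)%N) ->
  exists2 c : 'I_n.+1 -> K, exists i, c i != 0 & \sum_i c i *: r i = 0.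
Proof.
move=> sr; pose M := \matrix_(i < n.+1, j < n) (r i)`_j.
have kerM : kermx M != 0.
  by rewrite -mxrank_eq0 mxrank_ker -lt0n subn_gt0 ltnS rank_leq_col.
pose v := nz_row (kermx M).
have v0 : v != 0 by rewrite nz_row_eq0.
have vM : v *m M = 0 by apply/sub_kermxP; exact: nz_row_sub.
exists (fun i => v 0 i).
  apply: NNPP => none; move/eqP: v0; apply; apply/rowP => i; rewrite mxE.
  by apply: NNPP => vi; apply: none; exists i; apply/eqP.
apply/polyP => j; rewrite coef_sum coef0.
case: (ltnP j n) => [jn|nj]; last first.
  by apply: big1 => i _; rewrite coefZ nth_default ?mulr0 // (leq_trans (sr i)).
have := congr1 (fun A : 'rV_n => A 0 (Ordinal jn)) vM; rewrite !mxE => vMj.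
by rewrite -[RHS]vMj; apply: eq_bigr => i _; rewrite coefZ mxE.
Qed.

(** With d = deg p, the d + 1 remainders of the products u_i = f^i g^(d-i) modulo [p] are linearly
    dependent. The same coefficients give a combination of the u_i equal to one of the differences
    u_i - (u_i mod p), whose value is too large for independence. *)
Lemma val_indep_eps_below f g p e n B v :
  val_indep f g -> f != 0 -> g != 0 -> (0 < n)%N ->
  (1 < size p)%N -> (0 < B)%N -> scaled nu n p = Some v ->
  lead (scaled nu n) e (poly_XaY p) v B ->
  (forall h, h != 0 -> (size h < size p)%N -> eps_below (scaled nu n) e h) ->
  eps_below (scaled nu n) e f -> eps_below (scaled nu n) e g -> False.
Proof.
move=> indep f0 g0 n0 p1 B0 pv lp minp fe ge.
have Hs := scaled_valuation HG Hnu n0; have Hks := @scaled_krull _ _ _ Hk n.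
have p0 : p != 0 by rewrite -size_poly_gt0 ltnW.
set d := (size p).-1; pose u i := f ^+ i * g ^+ (d - i).
have u0 i : u i != 0 by rewrite mulf_neq0 // expf_neq0.
have ult i : vlt (nu (u i)) (nu (u i - u i %% p)).
  rewrite -(vlt_muln HG _ _ n0).
  apply: (@eps_below_modp _ _ HG _ Hs Hks e p v B p1 B0 lp pv minp (u i) (u0 i)).
  have [x fx] := krull_Some Hks f0; have [y gy] := krull_Some Hks g0.
  have lf := eps_below_lead HG fx fe; have lg := eps_below_lead HG gy ge.
  have := lead_mul HG Hs (lead_exp HG Hs i lf) (lead_exp HG Hs (d - i) lg).
  by rewrite !mul0n -!poly_XaYX -poly_XaYM => /lead_eps_below.
have small q : (size (q %% p)%R <= d)%N.
  by rewrite /d -ltnS (ltn_predK p1) ltn_modp.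
have [c c0 cr] := @poly_family_dep d (fun i => u i %% p) (fun i => small (u i)).
have [k [ck lk ek]] := indep d c c0.
have [x kx] : exists x, nu (c k *: u k) = Some x.
  by apply: krull_Some => //; rewrite scaler_eq0 negb_or ck u0.
suff : vlt (Some x) (nu (\sum_i c i *: u i)) by rewrite ek kx vlt_irr.
have -> : \sum_i c i *: u i = \sum_i c i *: (u i - u i %% p).
  rewrite -[LHS]subr0 -[X in _ - X]cr -sumrB; apply: eq_bigr => i _.
  by rewrite scalerBr.
apply: nu_lt_sum => // i _; have [->|ci] := eqVneq (c i) 0.
  by rewrite scale0r nu0.
apply: vle_lt_trans (_ : vlt (nu (c i *: u i)) _); first by rewrite -kx; apply: lk.
have [z cz] := nuC_Some Hnu ci.
by rewrite !nu_scale // cz vlt_add2l.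
Qed.

Lemma residue_transcendental_indep : residue_transcendental nu ->
  exists f g, [/\ f != 0, g != 0 & val_indep f g].
Proof.
move=> [_ [f [g [vg [gv [gf trans]]]]]].
have g0 : g != 0 by apply/negP => /eqP E; rewrite E nu0 in gv.
have fv : nu f = Some vg.
  (* The polynomial t evaluates at f/g, after homogenization, to [f]; hence nu(f) = nu(g). *)
  have := trans 'X; rewrite size_polyX /= mulr1n.
  rewrite big_ord_recl big_ord1 /= !coefX /= scale0r add0r scale1r subnn expr0 mulr1 expr1.
  apply=> [i|]; last by exists 1%N; rewrite coefX nu1.
  by rewrite coefX; case: eqP; rewrite ?nu1 ?nu0 //= vle_refl.
have f0 : f != 0 by apply/negP => /eqP E; rewrite E nu0 in fv.
exists f, g; split=> // n c [i0 ci0].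
have uv (i : 'I_n.+1) : nu (f ^+ i * g ^+ (n - i)) = Some (vg *+ n).
  by rewrite nuM // (nuX Hnu _ fv) (nuX Hnu _ gv) /= -mulrnDr subnKC // -ltnS.
pose T j := nu (c (inord j))%:P.
have [|k0 [x [kN Tk l _]]] := @last_argmin _ HG T n.+1.
  exists (i0 : nat) => //; rewrite /T inord_val.
  by have [z ->] := nuC_Some Hnu ci0.
pose k := Ordinal kN; have kx : nu (c k)%:P = Some x.
  by rewrite -Tk /T; congr (nu (c _)%:P); apply/val_inj; rewrite /= inordK.
have lx i : vle (Some x) (nu (c i)%:P) by have := l i (ltn_ord i); rewrite /T inord_val.
have ck : c k != 0 by apply/negP => /eqP E; rewrite E polyC0 nu0 in kx.
have ckV := nuC_inv Hnu ck kx.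
exists k; split=> // [i|]; first by rewrite !nu_scale // !uv kx vle_add // vle_refl.
(* Dividing by a coefficient of least value makes all coefficients integral and the one of index [k]
   equal to 1, as the transcendence hypothesis requires. *)
pose P := \poly_(i < n.+1) (c (inord i) / c k).
have Pi (i : 'I_n.+1) : P`_i = c i / c k by rewrite coef_poly ltn_ord inord_val.
have sP : (size P <= n.+1)%N by exact: size_poly.
have Pk : P`_k = 1 by rewrite Pi divff.
have P0 : (0 < size P)%N.
  by rewrite ltnNge leqn0; apply/negP => /eqP E; move: Pk; rewrite nth_default ?E // => /eqP; rewrite eq_sym oner_eq0.
have := trans P; set m := (size P).-1 => /(_ _ _)h.
have {}h : nu (\sum_(i < size P) P`_i *: (f ^+ i * g ^+ (m - i))) = Some (vg *+ m).
  apply: h; last by exists k; rewrite Pk nu1.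
  move=> i; case: (ltnP i n.+1) => [iN|Ni]; last first.
    by rewrite nth_default ?nu0 ?vle_None // (leq_trans sP).
  rewrite (Pi (Ordinal iN)) polyCM nuM // ckV.
  by have := lx (Ordinal iN); case: (nu _) => //= z xz; rewrite -(og_leD2r HG _ _ x) add0r subrK.
have mn : (m <= n)%N by rewrite -ltnS /m prednK.
(* The degree m of [P] may be less than n, whence the extra factor g^(n-m). *)
have -> : \sum_i c i *: (f ^+ i * g ^+ (n - i)) =
    (c k)%:P * (g ^+ (n - m) * \sum_(i < size P) P`_i *: (f ^+ i * g ^+ (m - i))).
  rewrite (big_ord_widen n.+1 (fun i => P`_i *: (f ^+ i * g ^+ (m - i))) sP).
  rewrite [in RHS]big_mkcond mulr_sumr mulr_sumr; apply: eq_bigr => i _.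
  case: ltnP => [im|mi]; last first.
    rewrite mulr0 mulr0; have : P`_i = 0 by rewrite nth_default.
    by rewrite Pi => /eqP; rewrite mulf_eq0 invr_eq0 (negPf ck) orbF => /eqP->; rewrite scale0r.
  rewrite mul_polyC -scalerAr scalerA Pi [c k * _]mulrC divfK //.
  by rewrite mulrCA -exprD addnBA ?subnK // -ltnS prednK.
by rewrite !nuM // h (nuX Hnu _ gv) nu_scale // kx uv /= -mulrnDr subnK.
Qed.

(** Equal finite values of the terms of indices i < j would give nu(c_i / c_j) = (j - i)(nu(f) -
    nu(g)), which is excluded; so the minimum is reached by one term only. *)
Lemma value_transcendental_indep : value_transcendental nu ->
  exists f g, [/\ f != 0, g != 0 & val_indep f g].
Proof.
case=> // -[_ [f [g [vf [vg [fv [gv trans]]]]]]].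
have f0 : f != 0 by apply/negP => /eqP E; rewrite E nu0 in fv.
have g0 : g != 0 by apply/negP => /eqP E; rewrite E nu0 in gv.
exists f, g; split=> // n c [i0 ci0].
have uv i : nu (f ^+ i * g ^+ (n - i)) = Some (vf *+ i + vg *+ (n - i)).
  by rewrite nuM // (nuX Hnu _ fv) (nuX Hnu _ gv).
pose T j := nu (c (inord j) *: (f ^+ j * g ^+ (n - j))).
have TE (i : 'I_n.+1) : T i = nu (c i *: (f ^+ i * g ^+ (n - i))).
  by rewrite /T inord_val.
have [|k0 [x [kN Tk l gt]]] := @last_argmin _ HG T n.+1.
  exists (i0 : nat) => //; rewrite TE nu_scale // uv.
  by have [z ->] := nuC_Some Hnu ci0.
pose k := Ordinal kN; have kx := Tk; rewrite (TE k) /= in kx.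
have ck : c k != 0 by apply/negP => /eqP E; rewrite E scale0r nu0 in kx.
have distinct (i j : 'I_n.+1) y : (i < j)%N -> T i = Some y -> T j = Some y -> False.
  rewrite !TE => ij; rewrite !nu_scale // !uv.
  case: (eqVneq (c i) 0) => [->|ci]; first by rewrite nu0.
  case: (eqVneq (c j) 0) => [->|cj]; first by rewrite nu0.
  have [a ia] := nuC_Some Hnu ci; have [b jb] := nuC_Some Hnu cj.
  rewrite ia jb /= => -[] <- [] E.
  apply: (trans (j - i)%N (c i / c j)); rewrite ?subn_gt0 //.
    by rewrite mulf_neq0 // invr_eq0.
  rewrite polyCM nuM // ia (nuC_inv Hnu cj jb) /=; congr Some; move: E.
  have -> : (n - i = (n - j) + (j - i))%N.
    by rewrite addnBA ?subnK // ?[(i <= j)%N]ltnW // -ltnS.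
  rewrite -{1}(subnK (ltnW ij)) [vf *+ _]mulrnDr [vg *+ (_ + _)]mulrnDr mulrnBl.
  move=> E; apply/eqP; rewrite subr_eq addrC; apply/eqP.
  apply: (addIr (vf *+ i + (vg *+ (n - j) + vg *+ (j - i)))); rewrite -E -!addrA.
  by congr (_ + (_ + _)); rewrite [RHS]addrC !addrA addrK.
have strict (i : 'I_n.+1) : i != k -> vlt (Some x) (T i).
  move=> ik; have [E|//] := vle_eqVlt (l i (ltn_ord i)).
  case: (ltngtP i k) => h.
  - by case: (distinct i k x h).
  - exact: gt.
  - by case/eqP: ik; apply/val_inj.
exists k; split=> // [i|]; first by rewrite kx -TE; apply: l.
rewrite (bigD1 k) //= nuD_eq // kx; apply: nu_lt_sum => // i ik.
by rewrite -TE; apply: strict.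
Qed.
End ValuationIndependence.

(** * Existence of the key polynomial *)

Section Existence.
Variables (K : fieldType) (G : porderZmodType) (HG : ordered_group G).
Variables (nu : {poly K} -> option G) (Hnu : valuation nu).
Implicit Types (f g h p : {poly K}).

Lemma ex_min_size (P : {poly K} -> Prop) :
  (exists f, P f) -> exists2 f, P f & forall g, P g -> (size f <= size g)%N.
Proof.
move=> [f]; move: {2}(size f) (leqnn (size f)) => n.
elim: n f => [|n IH] f fn Pf.
  by exists f => // g _; rewrite (leq_trans fn).
case: (classic (exists2 g, P g & (size g <= n)%N)) => [[g Pg gn]|none].
  exact: IH gn Pg.
exists f => // g Pg; rewrite (leq_trans fn) // ltnNge; apply/negP => gn.
by apply: none; exists g.
Qed.

Lemma krull_is_eps f (w : epsv G) : krull nu -> is_eps nu f w ->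
  f != 0 /\ w = eps_fin nu f.
Proof.
move=> Hk [f0 [[f1 ->]|[[gen _]|[_ [_ ->]]]]]; split=> //.
  by rewrite eps_fin_const // f1.
by case/eqP: f0; apply: Hk; apply/gen.
Qed.

(** If some epsilon exceeded the maximum M for [f] and [g], a polynomial p of least degree with this
    property would have eps(h) <= M < eps(p) for all h of smaller degree, against
    [val_indep_eps_below]. *)
Lemma val_indep_max_eps f g : krull nu -> f != 0 -> g != 0 ->
  val_indep nu f g -> forall h, h != 0 ->
  eps_le (eps_fin nu h) (eps_max (eps_fin nu f) (eps_fin nu g)).
Proof.
move=> Hk f0 g0 indep; set M := eps_max _ _.
have fM : eps_le (eps_fin nu f) M.
  by rewrite /M /eps_max; case: ifP => // _; exact: eps_le_refl.
have gM : eps_le (eps_fin nu g) M.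
  rewrite /M /eps_max; case: ifP => [_|/negbT]; first exact: eps_le_refl.
  by have := eps_le_total HG (eps_fin nu f) (eps_fin nu g); case/orP=> [->|].
have Mpos : eps_denom_pos M.
  by rewrite /M /eps_max; case: ifP => _; apply: eps_fin_pos.
move=> h0 h0n0; apply: contraT => hM.
have [|p [p0 pM] minp] := @ex_min_size (fun h => h != 0 /\ ~~ eps_le (eps_fin nu h) M).
  by exists h0.
have p1 : (1 < size p)%N.
  by rewrite ltnNge; apply: contraNN pM => /eps_fin_const->.
have [e [n [B [v [E n0 B0 pv lp]]]]] := eps_fin_key HG Hnu Hk p1.
have below h : h != 0 -> eps_le (eps_fin nu h) M -> eps_below (scaled nu n) e h.
  move=> hn0 hle; apply: eps_lt_below => //; apply: contraNN pM => ph.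
  by rewrite E; apply: eps_le_trans ph hle => //; apply: eps_fin_pos.
case: (@val_indep_eps_below _ _ HG _ Hnu Hk f g p e n B v) => //.
- move=> h hn0 hp; apply: below => //; apply: contraT => hM'.
  by have := minp h (conj hn0 hM'); rewrite leqNgt hp.
- exact: below.
- exact: below.
Qed.

Lemma krull_key_poly f g : krull nu -> f != 0 -> g != 0 -> val_indep nu f g ->
  exists Q, key_poly nu Q /\ (1 < size Q)%N /\ forall h, nu h = nuQ nu Q h.
Proof.
move=> Hk f0 g0 indep; have := val_indep_max_eps Hk f0 g0 indep.
set M := eps_max _ _ => leM.
have Mpos : eps_denom_pos M.
  by rewrite /M /eps_max; case: ifP => _; apply: eps_fin_pos.
(* The epsilon of ['X] is finite and bounded by [M], so a polynomial attaining [M] is not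
   constant. *)
have MN : M <> EpsNInf G.
  have := leM 'X; rewrite polyX_eq0 => /(_ isT).
  have [|e [n [B [v [-> _]]]]] := @eps_fin_key _ _ HG nu Hnu Hk 'X.
    by rewrite size_polyX.
  by case: (M).
have [|p [p0 pM] minp] := @ex_min_size (fun h => h != 0 /\ eps_le M (eps_fin nu h)).
  by rewrite /M /eps_max; case: ifP => _; [exists g | exists f]; split=> //;
    apply: eps_le_refl.
have p1 : (1 < size p)%N.
  rewrite ltnNge; apply/negP => /eps_fin_const pN.
  by move: pM; rewrite pN; case: (M) MN.
have k0 : (lead_coef p)^-1 != 0 by rewrite invr_eq0 lead_coef_eq0.
pose Q : {poly K} := (lead_coef p)^-1 *: p.
have sQ : size Q = size p by rewrite size_scale.
have Q1 : (1 < size Q)%N by rewrite sQ.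
have Q0 : Q != 0 by rewrite -size_poly_gt0 ltnW.
have Qm : Q \is monic by rewrite monicE lead_coefZ mulVf // lead_coef_eq0.
have QM : eps_le M (eps_fin nu Q).
  by apply: eps_le_trans pM (eps_fin_scale _ _ _ k0 p1) => //; apply: eps_fin_pos.
exists Q; split; [split=> //; split|split=> // h].
- exists (eps_fin nu Q); split=> //; right; right; split=> //; split=> // h hn0 hN.
  by case/eqP: hn0; apply: Hk.
- move=> h eh eQ /(krull_is_eps Hk)[hn0 ->] /(krull_is_eps Hk)[_ ->] Qh.
  by rewrite sQ; apply: minp; split=> //; apply: eps_le_trans QM Qh => //; apply: eps_fin_pos.
have [->|hn0] := eqVneq h 0; first by rewrite /nuQ size_poly0 big_ord0 nu0.
have [e [n [B [v [E n0 B0 Qv lQ]]]]] := eps_fin_key HG Hnu Hk Q1.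
have Hs := scaled_valuation HG Hnu n0; have Hks := @scaled_krull _ _ _ Hk n.
(* A [q] with eps(q) >= eps(Q) >= M would contradict the minimality of deg p. *)
have minQ (q : {poly K}) : q != 0 -> (size q < size Q)%N -> eps_below (scaled nu n) e q.
  move=> q0 qQ; apply: eps_lt_below => //; apply/negP => Qq.
  suff : (size p <= size q)%N by rewrite leqNgt -sQ qQ.
  by apply: minp; split=> //; rewrite -E in Qq; apply: eps_le_trans QM Qq => //; apply: eps_fin_pos.
have hle : eps_at_most (scaled nu n) e h.
  by apply/eps_le_at_most => //; rewrite -E; apply: eps_le_trans (leM h hn0) QM.
have [s [sh hs lh]] :=
  eps_at_most_expansion HG Hs Hks Q1 B0 lQ Qv minQ hn0 hle.
rewrite /nuQ; apply/esym.
apply: (@big_vmin_eq _ HG (size h) (fun i => nu (qcoef Q h i * Q ^+ i)) _ s) => //.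
  exact: vmuln_inj hs.
by move=> i /lh; rewrite /scaled vle_muln.
Qed.

Lemma eps_fin_neq_inf f : eps_fin nu f <> EpsInf G.
Proof.
have cand b u : eps_cand nu f b = Some u -> u <> EpsInf G.
  by rewrite /eps_cand; case: (nu f) => // x; case: (nu _) => // y [<-].
rewrite /eps_fin; elim: (iota _ _) => //= b s IH.
by case E : (eps_cand nu f b) => [u|] //; rewrite /eps_max; case: ifP => // _; apply: cand E.
Qed.

Lemma nuD_None a b : nu b = None -> nu (a + b) = nu a.
Proof.
move=> bN; apply: vle_anti; last by apply: nu_leD; rewrite ?bN ?vle_None ?vle_refl.
rewrite -[X in vle _ (nu X)](addrK b); apply: nu_leD; rewrite ?nuN ?bN ?vle_None //.
exact: vle_refl.
Qed.

Lemma not_krull_key_poly : ~ krull nu ->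
  exists Q, key_poly nu Q /\ (1 < size Q)%N /\ forall h, nu h = nuQ nu Q h.
Proof.
move=> nk; have [|p [p0 pN] minp] := @ex_min_size (fun h => h != 0 /\ nu h = None).
  apply: NNPP => none; apply: nk => h hN; apply: NNPP => h0; apply: none.
  by exists h; split=> //; apply/eqP.
have k0 : (lead_coef p)^-1 != 0 by rewrite invr_eq0 lead_coef_eq0.
pose Q : {poly K} := (lead_coef p)^-1 *: p.
have sQ : size Q = size p by rewrite size_scale.
have QN : nu Q = None by rewrite nu_scale // pN vaddC.
have Q0 : Q != 0 by rewrite scaler_eq0 negb_or k0.
have Q1 : (1 < size Q)%N.
  rewrite ltnNge; apply/negP => /size1_polyC E.
  have : Q`_0 != 0 by rewrite -polyC_eq0 -E.
  by case/(nuC_Some Hnu)=> x; rewrite -E QN.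
have Qm : Q \is monic by rewrite monicE lead_coefZ mulVf // lead_coef_eq0.
have dvN h : Q %| h -> nu h = None.
  by move=> /dvdpP[q ->]; rewrite nuM // QN vaddC.
(* Elements of the support do not change values, so only the digit of index 0 of a Q-expansion
   matters. *)
have modE h : nu (h %% Q) = nu h.
  by rewrite [in RHS](divp_eq h Q) addrC nuD_None // dvN // dvdp_mulIr.
have gen : generates_supp nu Q.
  move=> h; split=> [hN|]; last exact: dvN.
  rewrite /dvdp; apply: contraT => r0.
  have := minp (h %% Q); rewrite modE => /(_ (conj r0 hN)).
  by rewrite -sQ leqNgt ltn_modp Q0.
exists Q; split; [split=> //; split|split=> // h].
- by exists (EpsInf G); split=> //; right; left.
- move=> h eh eQ [h0 eh_] [_ eQ_].
  (* [Q] is a nonconstant element of the support, which leaves only the value infinity; eps(h) =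
     infinity then makes [h] a generator too, hence a multiple of [Q]. *)
  have -> : eQ = EpsInf G.
    case: eQ_ => [[s1 _]|[[]//|[_ [below _]]]]; first by rewrite s1 in Q1.
    by have := below Q Q0 QN; rewrite ltnn.
  case: eh_ => [[_ ->] //|[[genh _] _|[_ [_ ->]]]].
    by rewrite dvdp_leq //; apply/gen/genh.
  by case E : (eps_fin nu h) => //; case: (eps_fin_neq_inf E).
have [->|hn0] := eqVneq h 0; first by rewrite /nuQ size_poly0 big_ord0 nu0.
rewrite /nuQ; apply/esym.
apply: (@big_vmin_eq _ HG (size h) (fun i => nu (qcoef Q h i * Q ^+ i)) _ 0%N) => //.
- by rewrite size_poly_gt0.
- by rewrite /qcoef expr0 divp1 mulr1 modE.
- case=> [|i] _; first by rewrite /qcoef expr0 divp1 mulr1 modE vle_refl.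
  by rewrite (dvN (_ * _)) ?vle_None // exprS mulrCA dvdp_mulIl.
Qed.
End Existence.

(** * The converse: a truncation is valuation-transcendental *)

Section Truncated.
Variables (K : fieldType) (G : porderZmodType) (HG : ordered_group G).
Variables (nu : {poly K} -> option G) (Hnu : valuation nu) (Q : {poly K}).
Hypotheses (Q1 : (1 < size Q)%N) (nuE : forall f, nu f = nuQ nu Q f).

(** Written out in powers of [Q], F(Q) is already a Q-expansion, with constant digits. *)
Lemma qcoef_comp (F : {poly K}) i : qcoef Q (F \Po Q) i = (F`_i)%:P.
Proof.
have small (c : K) : (size c%:P < size Q)%N by rewrite (leq_ltn_trans (size_polyC_leq1 c)).
rewrite /qcoef; elim/poly_ind: F i => [|F c IH] i.
  by rewrite comp_poly0 div0p mod0p coef0.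
rewrite comp_poly_MXaddC coefD coefMX coefC; case: i => [|i] /=.
  by rewrite expr0 divp1 modp_addl_mul_small // add0r.
by rewrite exprS -divp_divl divp_addl_mul_small // IH addr0.
Qed.

Lemma nu_comp_eq (F : {poly K}) x j :
  (forall i, vle (Some x) (nu ((F`_i)%:P * Q ^+ i))) ->
  nu ((F`_j)%:P * Q ^+ j) = Some x -> nu (F \Po Q) = Some x.
Proof.
move=> l ej; rewrite nuE /nuQ.
apply: (@big_vmin_eq _ HG _ (fun i => nu (qcoef Q (F \Po Q) i * Q ^+ i)) _ j).
(* The minimum in [nuQ] runs below the size of F(Q), which is at least that of [F] since [Q] is
   nonconstant; so the index [j] is included. *)
- have Fj : F`_j != 0 by apply/negP => /eqP E; rewrite E mul0r nu0 in ej.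
  have jF : (j < size F)%N.
    by rewrite ltnNge; apply: contraNN Fj => h; rewrite nth_default.
  have F0 : F != 0 by rewrite -size_poly_gt0 (leq_ltn_trans _ jF).
  have FQ0 : F \Po Q != 0 by rewrite comp_poly_eq0.
  rewrite (leq_trans jF) // (polySpred FQ0) size_comp_poly {1}(polySpred F0).
  by rewrite ltnS leq_pmulr // -subn1 subn_gt0.
- by rewrite qcoef_comp.
- by move=> i _; rewrite qcoef_comp.
Qed.

Lemma truncation_transcendental : valuation_transcendental nu.
Proof.
case: (classic (krull nu)) => [Hk|nk]; last by left; left.
have Q0 : Q != 0 by rewrite -size_poly_gt0 ltnW.
have [v Qv] := krull_Some Hk Q0.
case: (classic (exists m (c : K), [/\ (0 < m)%N, c != 0 & nu c%:P = Some (v *+ m)]));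
  last first.
  (* The witness is Q/1: no positive multiple of nu(Q) lies in nu K. *)
  move=> none; left; right; split=> //; exists Q, 1, v, 0; rewrite nu1 //.
  split=> //; split=> // m c m0 c0; rewrite subr0 => E; apply: none.
  by exists m, c.
move=> [m [c [m0 c0 cE]]]; right; split=> //.
exists (Q ^+ m), c%:P, (v *+ m); split=> //; split.
  by rewrite (nuX Hnu _ Qv) vle_refl.
move=> P Pge [j Pj]; set d := (size P).-1.
(* Clearing denominators, c^d P(Q^m / c) = H(Q^m). Since nu(c) = m v, its term of index i has value
   nu(P_i) + d m v, least where nu(P_i) = 0. *)
pose H := \poly_(i < size P) (P`_i * c ^+ (d - i)).
have -> : \sum_(i < size P) P`_i *: (Q ^+ m ^+ i * c%:P ^+ (d - i)) = (H \Po 'X^m) \Po Q.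
  rewrite -comp_polyA comp_Xn_poly /H poly_def raddf_sum /=.
  apply: eq_bigr => i _; rewrite comp_polyZ comp_Xn_poly -scalerA; congr (_ *: _).
  by rewrite -polyC_exp mulrC mul_polyC.
have Hi i : (i < size P)%N ->
    nu ((H`_i)%:P * Q ^+ (m * i)) = vadd (nu (P`_i)%:P) (Some (v *+ m *+ d)).
  move=> iP; rewrite coef_poly iP polyCM -mulrA nuM //; congr vadd.
  rewrite nuM // polyC_exp (nuX Hnu _ cE) (nuX Hnu _ Qv) /=; congr Some.
  by rewrite mulrnA -mulrnDr subnK // -ltnS /d (ltn_predK iP).
have jP : (j < size P)%N.
  by rewrite ltnNge; apply/negP => h; rewrite nth_default ?nu0 in Pj.
apply: (@nu_comp_eq _ _ (m * j)) => [i|]; rewrite coef_comp_poly_Xn //; last first.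
  by rewrite dvdn_mulr // mulKn // Hi // Pj vadd0.
(* Only multiples of m carry nonzero coefficients of H(X^m). *)
case: dvdnP => [[i' ->]|_]; last by rewrite mul0r nu0 ?vle_None.
rewrite mulnK // mulnC; case: (ltnP i' (size P)) => [iP|Pi].
  by rewrite Hi // -{1}[Some (v *+ m *+ d)]vadd0 vle_add // vle_refl.
by rewrite coef_poly ltnNge Pi mul0r nu0 ?vle_None.
Qed.
End Truncated.

(** The condition [1 < size Q] is the nonconstancy under which the truncation nu_Q is defined. *)
Theorem theorem1p1 (K : fieldType) (G : porderZmodType) (HG : ordered_group G)
    (nu : {poly K} -> option G) (Hnu : valuation nu) :
  valuation_transcendental nu <->
  exists Q : {poly K},
    key_poly nu Q /\ (1 < size Q)%N /\ (forall f, nu f = nuQ nu Q f).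
Proof.
split=> [trans|[Q [_ [Q1 nuE]]]]; last exact: truncation_transcendental nuE.
case: (classic (krull nu)) => [Hk|]; last exact: not_krull_key_poly.
have [f [g [f0 g0 indep]]] : exists f g, [/\ f != 0, g != 0 & val_indep nu f g].
  case: trans; first exact: value_transcendental_indep.
  exact: residue_transcendental_indep.
exact: krull_key_poly indep.
Qed.
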